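(* Let $s,p\in(1,2]$, $r>0$ and let $m,n$ be positive integers. The set $\mathbb{B}_{s,p}(r)=\{X\in\mathbb{R}^{m\times n}:\|X\|_{s,p}\le r\}$ is $\frac{(s-1)(p-1)}{(s+p-2)r}$-strongly convex with respect to the norm $\|\cdot\|_{s,p}$ and $n^{\frac12-\frac1s}\,m^{\frac12-\frac1p}\,\frac{(s-1)(p-1)}{(s+p-2)r}$-strongly convex with respect to the Frobenius norm $\|\cdot\|_F$.
   Context: For $X\in\mathbb{R}^{m\times n}$ let $X_i\in\mathbb{R}^n$ denote its $i$th row. The group norm is $\|X\|_{s,p}=\big\|(\|X_1\|_s,\|X_2\|_s,\dots,\|X_m\|_s)\big\|_p$, where $\|\cdot\|_s$ and $\|\cdot\|_p$ are the usual $\ell_s$ and $\ell_p$ vector norms. A convex set $\mathcal{K}$ in a finite-dimensional real vector space $E$ is $\alpha$-strongly convex with respect to a norm $\|\cdot\|$ on $E$ if for any $x,y\in\mathcal{K}$, any $\gamma\in[0,1]$ and any $z\in E$ with $\|z\|=1$, it holds that $\gamma x+(1-\gamma)y+\gamma(1-\gamma)\frac{\alpha}{2}\|x-y\|^2 z\in\mathcal{K}$. *)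

(* Defs.v *)
From mathcomp Require Import all_boot all_order all_algebra.
From mathcomp Require Import all_classical all_reals all_analysis.

Set Implicit Arguments.
Unset Strict Implicit.
Unset Printing Implicit Defensive.

Import Order.TTheory GRing.Theory Num.Theory.

Local Open Scope classical_set_scope.
Local Open Scope ring_scope.

Definition lp_norm (R : realType) (p : R) (n : nat) (v : 'rV[R]_n) : R :=
  (\sum_(j < n) `|v 0 j| `^ p) `^ p^-1.

(* Inner exponent s on the rows, outer exponent p across the rows. *)
Definition group_norm (R : realType) (s p : R) (m n : nat)
    (X : 'M[R]_(m, n)) : R :=
  lp_norm p (\row_(i < m) lp_norm s (row i X)).

(* Not the library norm `|X| of a matrix, which is the maximum of the absolute
   values of its entries. *)
Definition frobenius_norm (R : realType) (m n : nat) (X : 'M[R]_(m, n)) : R :=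
  Num.sqrt (\sum_(i < m) \sum_(j < n) X i j ^+ 2).

Definition group_ball (R : realType) (s p : R) (m n : nat) (r : R) :
    set 'M[R]_(m, n) :=
  [set X | group_norm s p X <= r].

(* The norm N is passed as a function because a space such as 'M[R]_(m, n) is
   considered here with several norms, none of them its canonical one. *)
Definition strongly_convex (R : realType) (E : vectType R) (N : E -> R)
    (alpha : R) (K : set E) : Prop :=
  convex_set (K : set (convex_lmodType E)) /\
  forall (x y : E) (gamma : R) (z : E),
    K x -> K y -> 0 <= gamma <= 1 -> N z = 1 ->
    K (gamma *: x + (1 - gamma) *: y
       + (gamma * (1 - gamma) * (alpha / 2) * N (x - y) ^+ 2) *: z).

(* Main.v *)
Require Import Defs.
From mathcomp Require Import all_boot all_order all_algebra.
From mathcomp Require Import all_classical all_reals all_analysis.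
From mathcomp Require Import ring lra.

(* Write N for the group norm and q = min(s, p).  The two-point inequality
     a^2 + (q-1) b^2 <= ((|a+b|^q + |a-b|^q) / 2)^(2/q)
   passes from scalars to matrices by Minkowski's inequality for mixed norms
   (the smaller exponent outside gives the larger norm), applied once with the
   outer exponent q <= s, p and once with the inner exponent 2 >= s, p.  This
   yields 2 (N(X)^2 + (q-1) N(Y)^2) <= N(X+Y)^2 + N(X-Y)^2, i.e. N^2 is
   midpoint strongly convex; being bounded on segments it is strongly convex,
     N(tX + (1-t)Y)^2 <= t N(X)^2 + (1-t) N(Y)^2 - (q-1) t(1-t) N(X-Y)^2.
   On the ball of radius r the right-hand side is at most r^2 - 2 r d with
   d = (q-1) t(1-t) N(X-Y)^2 / (2r), whence N(tX + (1-t)Y) <= r - d, and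
   (s-1)(p-1)/(s+p-2) <= q-1.  For the Frobenius norm F one combines this with
   n^(1/2-1/s) m^(1/2-1/p) N <= F <= N. *)

Import Order.TTheory GRing.Theory Num.Theory.
Local Open Scope ring_scope.

(** * Finite l_p norms: triangle, Minkowski and power mean inequalities *)

Definition lpn {R : realType} {I : finType} (p : R) (f : I -> R) : R :=
  (\sum_i `|f i| `^ p) `^ p^-1.

Section Lpn.
Set Implicit Arguments.
Unset Strict Implicit.
Context {R : realType}.
Implicit Types (a b c p q t u v : R) (I J : finType).

(** Young's inequality for the product [u * 1] with conjugate exponents [p] and [p / (p - 1)],
    multiplied by [p]; at [p = 1] the second exponent would be infinite, hence the separate case. *)
Lemma powR_bernoulli u p : 0 <= u -> 1 <= p -> 1 + p * (u - 1) <= u `^ p.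
Proof.
move=> u0; rewrite le_eqVlt => /predU1P[<-|p1]; first by rewrite powRr1; lra.
have p0 : 0 < p by lra.
have q0 : 0 < p / (p - 1) by rewrite divr_gt0//; lra.
have pq : p^-1 + (p / (p - 1))^-1 = 1 by rewrite invf_div; field; rewrite gt_eqF.
have := conjugate_powR u0 ler01 p0 q0 pq.
rewrite mulr1 powR1 div1r invf_div => /(ler_wpM2l (ltW p0)).
have -> : p * (u `^ p / p + (p - 1) / p) = u `^ p + (p - 1).
  by field; rewrite gt_eqF.
by lra.
Qed.

Lemma powRK p u : 0 < p -> 0 <= u -> (u `^ p) `^ p^-1 = u.
Proof. by move=> p0 u0; rewrite -powRrM divff ?gt_eqF// powRr1. Qed.

Lemma powRVK p u : 0 < p -> 0 <= u -> (u `^ p^-1) `^ p = u.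
Proof. by move=> p0 u0; rewrite -powRrM mulVf ?gt_eqF// powRr1. Qed.

Lemma ler_powR2 p u v : 0 <= p -> 0 <= u -> u <= v -> u `^ p <= v `^ p.
Proof. by move=> *; rewrite ge0_ler_powR ?nnegrE//; lra. Qed.

Lemma lpn_ge0 I p (f : I -> R) : 0 <= lpn p f.
Proof. exact: powR_ge0. Qed.

Lemma sum_powR_ge0 I p (f : I -> R) : 0 <= \sum_i `|f i| `^ p.
Proof. by apply: sumr_ge0 => i _; exact: powR_ge0. Qed.

Lemma lpnK I p (f : I -> R) : 0 < p -> lpn p f `^ p = \sum_i `|f i| `^ p.
Proof. by move=> p0; rewrite powRVK// sum_powR_ge0. Qed.

Lemma eq_lpn I p (f g : I -> R) : f =1 g -> lpn p f = lpn p g.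
Proof. by move=> fg; rewrite /lpn; under eq_bigr do rewrite fg. Qed.

Lemma le_lpn I p (f g : I -> R) : 0 <= p ->
  (forall i, `|f i| <= `|g i|) -> lpn p f <= lpn p g.
Proof.
move=> p0 fg; apply: ler_powR2; rewrite ?invr_ge0 ?sum_powR_ge0//.
by apply: ler_sum => i _; exact: ler_powR2.
Qed.

Lemma lpnZ I p c (f : I -> R) : 0 < p ->
  lpn p (fun i => c * f i) = `|c| * lpn p f.
Proof.
move=> p0; rewrite /lpn; under eq_bigr do rewrite normrM powRM//.
by rewrite -mulr_sumr powRM ?powR_ge0 ?sum_powR_ge0// powRK.
Qed.

Lemma lpn0 I p : p != 0 -> lpn p (fun _ : I => 0) = 0.
Proof.
by move=> p0; rewrite /lpn big1 ?powR0 ?invr_eq0// => i _; rewrite normr0 powR0.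
Qed.

(** Convexity of the [p]-th power at the points [u / a] and [v / b], whose mean with weights
    [a / (a + b)] and [b / (a + b)] is [(u + v) / (a + b)]. *)
Lemma powRD_le p a b u v : 1 <= p -> 0 < a -> 0 < b -> 0 <= u -> 0 <= v ->
  (u + v) `^ p <= (a + b) `^ p *
    (a / (a + b) * (u `^ p / a `^ p) + b / (a + b) * (v `^ p / b `^ p)).
Proof.
move=> p1 a0 b0 u0 v0.
have ab0 : 0 < a + b by rewrite addr_gt0.
have t0 : 0 <= a / (a + b) by rewrite divr_ge0// ltW.
have t1 : a / (a + b) <= 1 by rewrite ler_pdivrMr// mul1r lerDl ltW.
have ua : 0 <= u / a by rewrite divr_ge0// ltW.
have vb : 0 <= v / b by rewrite divr_ge0// ltW.
have : (a / (a + b) * (u / a) + (1 - a / (a + b)) * (v / b)) `^ p <=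
    a / (a + b) * (u / a) `^ p + (1 - a / (a + b)) * (v / b) `^ p.
  by apply: (convex_powR p1 (Itv01 t0 t1)); rewrite inE/= in_itv/= andbT.
have -> : 1 - a / (a + b) = b / (a + b) by field; rewrite gt_eqF.
have -> : a / (a + b) * (u / a) + b / (a + b) * (v / b) = (u + v) / (a + b).
  by field; rewrite !gt_eqF.
have divE x y : 0 <= x -> 0 < y -> (x / y) `^ p = x `^ p / y `^ p.
  move=> x0 y0; rewrite powRM ?invr_ge0 ?(ltW y0)//.
  by rewrite -[y^-1]powR_inv1 ?(ltW y0)// -powRrM mulN1r powRN.
rewrite !divE ?addr_ge0// => h.
by rewrite [leRHS]mulrC -ler_pdivrMr// powR_gt0.
Qed.

(** Summing [powRD_le] over the coordinates leaves weights that add up to 1. The positive bounds [a]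
    and [b] stand in for the norms, which may vanish and so cannot be divided by. *)
Lemma lpnD_le_of_le I p a b (f g : I -> R) : 1 <= p -> 0 < a -> 0 < b ->
  lpn p f <= a -> lpn p g <= b -> lpn p (fun i => f i + g i) <= a + b.
Proof.
move=> p1 a0 b0 fa gb; have p0 : 0 < p := lt_le_trans ltr01 p1.
have {}fa : \sum_i `|f i| `^ p <= a `^ p.
  by rewrite -(lpnK f p0); apply: ler_powR2 => //; [exact: ltW|exact: lpn_ge0].
have {}gb : \sum_i `|g i| `^ p <= b `^ p.
  by rewrite -(lpnK g p0); apply: ler_powR2 => //; [exact: ltW|exact: lpn_ge0].
have ab0 : 0 <= a + b by rewrite addr_ge0// ltW.
rewrite -[leRHS](powRK p0 ab0) /lpn.
apply: ler_powR2; [by rewrite invr_ge0 ltW|exact: sum_powR_ge0|].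
apply: (@le_trans _ _ (\sum_i (a + b) `^ p *
    (a / (a + b) * (`|f i| `^ p / a `^ p) + b / (a + b) * (`|g i| `^ p / b `^ p)))).
  apply: ler_sum => i _.
  apply: le_trans (powRD_le p1 a0 b0 (normr_ge0 _) (normr_ge0 _)).
  by apply: ler_powR2; [exact: ltW|exact: normr_ge0|exact: ler_normD].
rewrite -mulr_sumr big_split/= -!mulr_sumr -!mulr_suml.
rewrite -[leRHS]mulr1; apply: ler_wpM2l; first exact: powR_ge0.
have -> : 1 = a / (a + b) + b / (a + b) by rewrite -mulrDl divff// gt_eqF// addr_gt0.
have le1 x y : 0 < y -> x <= y `^ p -> x / y `^ p <= 1.
  by move=> y0 xy; rewrite ler_pdivrMr ?powR_gt0// mul1r.
by apply: lerD; apply: ler_piMr; rewrite ?le1// divr_ge0// ltW.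
Qed.

Lemma lpnD_le I p (f g : I -> R) : 1 <= p ->
  lpn p (fun i => f i + g i) <= lpn p f + lpn p g.
Proof.
(* A slack of [e / 2] on each norm makes both bounds positive. *)
move=> p1; apply/ler_addgt0Pr => e e0.
have e20 : 0 < e / 2 by lra.
rewrite [e]splitr addrACA; apply: lpnD_le_of_le => //.
- by rewrite ltr_wpDl// lpn_ge0.
- by rewrite ltr_wpDl// lpn_ge0.
- by rewrite lerDl ltW.
- by rewrite lerDl ltW.
Qed.

Lemma lpn_sum_le I J p (f : I -> J -> R) : 1 <= p ->
  lpn p (fun j => \sum_i f i j) <= \sum_i lpn p (f i).
Proof.
move=> p1; elim: (index_enum I) => [|i r ih].
  by rewrite big_nil (@eq_lpn _ _ _ (fun=> 0)) ?lpn0 ?gt_eqF//; [lra|move=> j; rewrite big_nil].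
rewrite big_cons (@eq_lpn _ _ _ (fun j => f i j + \sum_(i <- r) f i j)).
  by apply: le_trans (lpnD_le _ _ p1) _; rewrite lerD2l.
by move=> j; rewrite big_cons.
Qed.

(* Raising to the power [a] turns this into the triangle inequality for the
   exponent [b / a], applied to the vectors [fun k => |f i k| ^ a]. *)
Lemma lpn_minkowski I J a b (f : I -> J -> R) : 0 < a -> a <= b ->
  lpn b (fun k => lpn a (f^~ k)) <= lpn a (fun i => lpn b (f i)).
Proof.
move=> a0 ab; have b0 : 0 < b := lt_le_trans a0 ab.
have P1 : 1 <= b / a by rewrite ler_pdivlMr// mul1r.
have ba : b = a * (b / a) by rewrite mulrC divfK// gt_eqF.
have lhs : lpn b (fun k => lpn a (f^~ k)) =
    lpn (b / a) (fun k => \sum_i `|f i k| `^ a) `^ a^-1.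
  rewrite /lpn -powRrM [(b / a)^-1 * _]mulrC -invfM -ba; congr (_ `^ _).
  apply: eq_bigr => k _; rewrite [in RHS]ger0_norm ?sum_powR_ge0//.
  by rewrite ger0_norm ?powR_ge0// -powRrM mulrC.
have rhs : lpn a (fun i => lpn b (f i)) =
    (\sum_i lpn (b / a) (fun k => `|f i k| `^ a)) `^ a^-1.
  rewrite [LHS]/lpn; congr (_ `^ _); apply: eq_bigr => i _.
  rewrite (ger0_norm (lpn_ge0 _ _)) /lpn -powRrM invf_div [b^-1 * a]mulrC.
  congr (_ `^ _); apply: eq_bigr => k _.
  by rewrite (ger0_norm (powR_ge0 _ _)) -powRrM -ba.
rewrite lhs rhs; apply: ler_powR2; [by rewrite invr_ge0 ltW|exact: lpn_ge0|].
exact: lpn_sum_le.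
Qed.

(* [lpn_minkowski] for the diagonal family. *)
Lemma lpn_exponent_le I a b (f : I -> R) : 0 < a -> a <= b ->
  lpn b f <= lpn a f.
Proof.
move=> a0 ab; have b0 : 0 < b := lt_le_trans a0 ab.
have single c k (g : I -> R) : 0 < c -> (forall i, i != k -> g i = 0) ->
    lpn c g = `|g k|.
  move=> c0 gk; rewrite /lpn (bigD1 k)//= big1 ?addr0 ?powRK//.
  by move=> i /gk ->; rewrite normr0 powR0// gt_eqF.
pose d i k := if i == k then f i else 0.
have dl k : lpn a (d^~ k) = `|f k|.
  by rewrite (single _ k) /d ?eqxx// => i /negbTE ->.
have dr i : lpn b (d i) = `|f i|.
  by rewrite (single _ i) /d ?eqxx// => k; rewrite eq_sym => /negbTE ->.
have abs c (g : I -> R) : lpn c (fun k => `|g k|) = lpn c g.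
  by rewrite /lpn; under eq_bigr do rewrite normr_id.
have := lpn_minkowski d a0 ab.
by rewrite (eq_lpn b dl) (eq_lpn a dr) !abs.
Qed.

(* [lpn_minkowski] for the family of all cyclic shifts of [f]. *)
Lemma lpn_power_mean n a b (f : 'I_n.+1 -> R) : 0 < a -> a <= b ->
  n.+1%:R `^ b^-1 * lpn a f <= n.+1%:R `^ a^-1 * lpn b f.
Proof.
move=> a0 ab; have b0 : 0 < b := lt_le_trans a0 ab.
have const c u : 0 < c -> 0 <= u -> lpn c (fun _ : 'I_n.+1 => u) = n.+1%:R `^ c^-1 * u.
  move=> c0 u0; rewrite /lpn sumr_const card_ord -[X in X `^ _ = _]mulr_natl.
  by rewrite powRM ?powR_ge0// powRK// ?normr_ge0// ger0_norm.
have shift c (k : 'I_n.+1) : lpn c (fun i => f (i + k)) = lpn c f.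
  by rewrite /lpn [in RHS](reindex_inj (addIr k)).
rewrite -(const _ _ b0 (lpn_ge0 a f)) -(const _ _ a0 (lpn_ge0 b f)).
rewrite (@eq_lpn _ b _ (fun k => lpn a (fun i => f (i + k)))); last by move=> k; rewrite shift.
rewrite (@eq_lpn _ a _ (fun i => lpn b (fun k => f (i + k)))).
  exact: (lpn_minkowski (fun i k => f (i + k))).
by move=> i; rewrite -(shift b i); apply: eq_lpn => k; rewrite addrC.
Qed.
End Lpn.

(** * The scalar two-point inequality *)

Section TwoPoint.
Set Implicit Arguments.
Unset Strict Implicit.
Context {R : realType}.
Implicit Types (a b c e p q t u v x : R) (I J : finType).

(** The interval is half-open because the power rule differentiates powers of [1 - t] only where
    [1 - t] is positive; [powR_add_ge] recovers the endpoint. *)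
Lemma is_derive_ge0_le (f f' : R -> R) :
  (forall t, 0 <= t < 1 -> is_derive t 1 f (f' t)) ->
  (forall t, 0 < t < 1 -> 0 <= f' t) ->
  forall t, 0 <= t < 1 -> f 0 <= f t.
Proof.
move=> fd f'0 t /andP[t0 t1].
have d x : x \in `[0, t]%R -> derivable f x 1.
  rewrite in_itv/= => /andP[x0 xt].
  have xd : is_derive x 1 f (f' x) by apply: fd; rewrite x0 (le_lt_trans xt).
  exact: ex_derive.
apply: (@ger0_derive1_ndecr R f 0 t) => //.
- move=> x; rewrite in_itv/= => /andP[x0 xt].
  by apply: d; rewrite in_itv/= !ltW.
- move=> x; rewrite in_itv/= => /andP[x0 xt].
  have x1 := lt_trans xt t1.
  have xd : is_derive x 1 f (f' x) by apply: fd; rewrite (ltW x0) x1.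
  by rewrite derive1E derive_val f'0// x0 x1.
- exact: derivable_within_continuous.
Qed.

Lemma is_derive_powR_affine c q t : 0 < 1 + c * t ->
  is_derive t 1 (fun t => (1 + c * t) `^ q) (q * (1 + c * t) `^ (q - 1) * c).
Proof.
move=> ct.
have g : is_derive t 1 (fun t => 1 + c * t) c.
  by apply: is_derive_eq; rewrite /GRing.scale/=; ring.
exact: (@is_derive1_comp R (fun x => x `^ q) (fun t => 1 + c * t) _ _ _ (is_derive1_powR _ ct) g).
Qed.

(** The product of the two terms is a nonpositive power of [1 - t ^+ 2], hence at least 1, and AM-GM
    bounds their sum. *)
Lemma powR_AGM e t : 0 <= t < 1 -> e <= 0 -> 2 <= (1 + t) `^ e + (1 - t) `^ e.
Proof.
move=> /andP[t0 t1] e0.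
have u0 : 0 < (1 + t) `^ e by apply: powR_gt0; lra.
have v0 : 0 < (1 - t) `^ e by apply: powR_gt0; lra.
have : 1 <= (1 + t) `^ e * (1 - t) `^ e.
  rewrite -powRM; [|lra|lra].
  by rewrite -[leLHS](powRr0 ((1 + t) * (1 - t))) ger_powR//; apply/andP; split; nra.
move: ((1 + t) `^ e) ((1 - t) `^ e) u0 v0 => u v u0 v0 uv.
have := sqr_ge0 (u - v); nra.
Qed.

(** Both sides agree at 0, and the derivative of the difference is nonnegative by [powR_AGM] with
    exponent [e - 1 <= 0]. *)
Lemma powR_sub_ge e t : 0 <= e <= 1 -> 0 <= t < 1 ->
  2 * e * t <= (1 + t) `^ e - (1 - t) `^ e.
Proof.
move=> /andP[e0 e1] t01.
(* The coefficients 1 and -1 give both powers the shape of [is_derive_powR_affine]. *)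
pose f t : R := (1 + 1 * t) `^ e - (1 + -1 * t) `^ e - 2 * e * t.
pose f' t : R := e * ((1 + t) `^ (e - 1) + (1 - t) `^ (e - 1) - 2).
have fd x : 0 <= x < 1 -> is_derive x 1 f (f' x).
  move=> /andP[x0 x1].
  have d1 : is_derive x 1 (fun t => (1 + 1 * t) `^ e) _ := @is_derive_powR_affine 1 e x ltac:(lra).
  have d2 : is_derive x 1 (fun t => (1 + -1 * t) `^ e) _ := @is_derive_powR_affine (-1) e x ltac:(lra).
  apply: is_derive_eq; rewrite /f' /GRing.scale/= mul1r mulN1r.
  ring.
have f'0 x : 0 < x < 1 -> 0 <= f' x.
  move=> /andP[x0 x1]; rewrite mulr_ge0// subr_ge0 powR_AGM//; last lra.
  by rewrite ltW.
have := is_derive_ge0_le fd f'0 t01.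
rewrite /f !mulr0 !addr0 powR1 mul1r mulN1r; lra.
Qed.

(** One more integration: the derivative of the difference is [q] times the gap in [powR_sub_ge] at
    exponent [q - 1]. *)
Lemma powR_add_ge_lt1 q t : 1 <= q <= 2 -> 0 <= t < 1 ->
  2 + q * (q - 1) * t ^+ 2 <= (1 + t) `^ q + (1 - t) `^ q.
Proof.
move=> /andP[q1 q2] t01.
pose f t : R := (1 + 1 * t) `^ q + (1 + -1 * t) `^ q - q * (q - 1) * (t * t).
pose f' t : R := q * ((1 + t) `^ (q - 1) - (1 - t) `^ (q - 1) - 2 * (q - 1) * t).
have fd x : 0 <= x < 1 -> is_derive x 1 f (f' x).
  move=> /andP[x0 x1].
  have d1 : is_derive x 1 (fun t => (1 + 1 * t) `^ q) _ := @is_derive_powR_affine 1 q x ltac:(lra).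
  have d2 : is_derive x 1 (fun t => (1 + -1 * t) `^ q) _ := @is_derive_powR_affine (-1) q x ltac:(lra).
  apply: is_derive_eq; rewrite /f' /GRing.scale/= mul1r mulN1r.
  ring.
have f'0 x : 0 < x < 1 -> 0 <= f' x.
  move=> /andP[x0 x1]; rewrite mulr_ge0 ?subr_ge0 ?powR_sub_ge//; [lra|apply/andP; split; lra|].
  by rewrite ltW.
have := is_derive_ge0_le fd f'0 t01.
rewrite /f !mulr0 !addr0 powR1 mul1r mulN1r expr2; lra.
Qed.

Lemma powR_add_ge q t : 1 <= q <= 2 -> 0 <= t <= 1 ->
  2 + q * (q - 1) * t ^+ 2 <= (1 + t) `^ q + (1 - t) `^ q.
Proof.
move=> q12 /andP[t0]; rewrite le_eqVlt => /predU1P[->|t1]; last first.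
  by apply: powR_add_ge_lt1; rewrite ?t0.
have /andP[q1 q2] := q12.
have q0 : 0 < q by lra.
rewrite subrr powR0 ?gt_eqF// addr0.
apply/ler_addgt0Pr => e e0.
(* Moving from 1 to [1 - d] costs at most [d] in the second power, as [d ^ q <= d], and at most
   [2 * q * (q - 1) * d] in the quadratic term; [d] keeps the total below [e]. *)
pose d : R := Num.min 1 (e / (1 + 2 * q * (q - 1))).
have D0 : 0 < 1 + 2 * q * (q - 1) by nra.
have d0 : 0 < d by rewrite lt_min ltr01 divr_gt0.
have d1 : d <= 1 by rewrite ge_min lexx.
have de : d * (1 + 2 * q * (q - 1)) <= e by rewrite -ler_pdivlMr// ge_min lexx orbT.
have := @powR_add_ge_lt1 q (1 - d) q12.
have -> : 0 <= 1 - d < 1 by apply/andP; split; lra.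
move=> /(_ isT).
have h1 : (1 + (1 - d)) `^ q <= (1 + 1) `^ q by apply: ler_powR2; lra.
have h2 : (1 - (1 - d)) `^ q <= d.
  by rewrite subKr ge1r_powR// d0.
move: h1 h2; move: (powR _ _) (powR _ _) (powR _ _) => A B C h1 h2 h3.
nra.
Qed.

(** Signs, symmetry and scaling reduce to [t = b / a] in [0, 1]. There [powR_add_ge] bounds the mean
    below by [1 + q * (q - 1) / 2 * t ^+ 2], and Bernoulli with exponent [2 / q >= 1] turns the
    coefficient into [q - 1]. *)
Lemma two_point_ineq q a b : 1 <= q <= 2 ->
  a ^+ 2 + (q - 1) * b ^+ 2 <= ((`|a + b| `^ q + `|a - b| `^ q) / 2) `^ (2 / q).
Proof.
move=> q12; have /andP[q1 q2] := q12.
have q0 : 0 < q by lra.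
have P1 : 1 <= 2 / q by rewrite ler_pdivlMr// mul1r.
wlog a0 : a b / 0 <= a => [h|].
  have [/h//|/ltW] := leP 0 a; rewrite -oppr_ge0 => /(h _ (- b)).
  by rewrite !sqrrN -!opprD !normrN.
wlog b0 : b / 0 <= b => [h|].
  have [/h//|/ltW] := leP 0 b; rewrite -oppr_ge0 => /h.
  by rewrite !sqrrN opprK [X in X / 2]addrC.
(* The right side is symmetric, and since [q - 1 <= 1] the left side is larger when the larger
   number carries coefficient 1. *)
wlog ba : a b a0 b0 / b <= a => [h|].
  have [/h|/ltW ab] := leP b a; first exact.
  rewrite [a + b]addrC [`|a - b|]distrC.
  apply: le_trans (h b a b0 a0 ab).
  have : 0 <= (2 - q) * ((b - a) * (b + a)) by rewrite !mulr_ge0//; lra.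
  by lra.
have [a_eq0|a_neq0] := eqVneq a 0.
  have -> : b = 0 by lra.
  rewrite a_eq0.
  by rewrite !expr0n/= mulr0 addr0 powR_ge0.
have {}a0 : 0 < a by rewrite lt_def a_neq0.
pose t := b / a.
have t0 : 0 <= t by rewrite divr_ge0// ltW.
have t1 : t <= 1 by rewrite ler_pdivrMr// mul1r.
have -> : b = a * t by rewrite mulrC divfK// gt_eqF.
have -> : `|a + a * t| = a * (1 + t) by rewrite ger0_norm; nra.
have -> : `|a - a * t| = a * (1 - t) by rewrite ger0_norm; nra.
have u0 : 0 <= 1 + t by lra.
have v0 : 0 <= 1 - t by lra.
rewrite (powRM q (ltW a0) u0) (powRM q (ltW a0) v0).
rewrite -mulrDr -mulrA powRM ?powR_ge0//; last first.
  by rewrite divr_ge0// addr_ge0 ?powR_ge0.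
rewrite -powRrM [q * _]mulrC divfK ?gt_eqF// powR_mulrn ?(ltW a0)//.
have : 1 + (q - 1) * t ^+ 2 <= (((1 + t) `^ q + (1 - t) `^ q) / 2) `^ (2 / q); last by nra.
have X0 : 0 <= q * (q - 1) / 2 * t ^+ 2 by rewrite mulr_ge0 ?sqr_ge0//; nra.
apply: le_trans (@ler_powR2 _ (2 / q) (1 + q * (q - 1) / 2 * t ^+ 2) _ _ _ _).
- apply: le_trans (powR_bernoulli _ P1); last by rewrite addr_ge0.
  by rewrite [leRHS](_ : _ = 1 + (q - 1) * t ^+ 2)//; field; rewrite gt_eqF.
- by rewrite divr_ge0 ?ltW.
- by rewrite addr_ge0.
- have := @powR_add_ge q t q12; rewrite t0 t1 => /(_ isT).
  by rewrite ler_pdivlMr//; nra.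
Qed.
End TwoPoint.

(** * Mixed norms and their uniform convexity *)

Definition mixed_norm {R : realType} {I J : finType} (s p : R) (f : I -> J -> R) : R :=
  lpn p (fun i => lpn s (f i)).

Section Mixed.
Set Implicit Arguments.
Unset Strict Implicit.
Context {R : realType}.
Implicit Types (a b c e p q r s t u v x : R) (I J K : finType).

Lemma sqr_le u v : 0 <= u -> u <= v -> u ^+ 2 <= v ^+ 2.
Proof. by move=> *; nra. Qed.

Lemma le_lpn_ge0 I p (f g : I -> R) : 0 <= p -> (forall i, 0 <= f i) ->
  (forall i, f i <= g i) -> lpn p f <= lpn p g.
Proof.
move=> p0 f0 fg; apply: le_lpn => // i.
by rewrite (ger0_norm (f0 i)) (ger0_norm (le_trans (f0 i) (fg i))).
Qed.

Lemma mixed_norm_ge0 I J s p (f : I -> J -> R) : 0 <= mixed_norm s p f.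
Proof. exact: lpn_ge0. Qed.

Lemma le_mixed_norm I J s p (f g : I -> J -> R) : 0 <= s -> 0 <= p ->
  (forall i j, 0 <= f i j) -> (forall i j, f i j <= g i j) ->
  mixed_norm s p f <= mixed_norm s p g.
Proof.
move=> s0 p0 f0 fg; apply: le_lpn_ge0 p0 _ _ => i; first exact: lpn_ge0.
exact: (le_lpn_ge0 s0 (f0 i) (fg i)).
Qed.

Lemma mixed_normZ I J s p c (f : I -> J -> R) : 0 < s -> 0 < p ->
  mixed_norm s p (fun i j => c * f i j) = `|c| * mixed_norm s p f.
Proof.
move=> s0 p0; rewrite /mixed_norm.
have -> : `|c| * lpn p (fun i => lpn s (f i)) = lpn p (fun i => `|c| * lpn s (f i)).
  by rewrite lpnZ// normr_id.
by apply: eq_lpn => i; rewrite lpnZ.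
Qed.

Lemma mixed_normD_le I J s p (f g : I -> J -> R) : 1 <= s -> 1 <= p ->
  mixed_norm s p (fun i j => f i j + g i j) <= mixed_norm s p f + mixed_norm s p g.
Proof.
move=> s1 p1; apply: le_trans (lpnD_le _ _ p1).
apply: le_lpn_ge0 => [|i|i]; [exact: le_trans ler01 p1|exact: lpn_ge0|].
exact: lpnD_le.
Qed.

(** Minkowski twice: the exponent [a], below both others, moves outwards first past [s] and then
    past [p]. *)
Lemma mixed_norm_lpn_le I J K a s p (F : K -> I -> J -> R) :
  0 < a -> a <= s -> a <= p ->
  mixed_norm s p (fun i j => lpn a (fun k => F k i j)) <=
  lpn a (fun k => mixed_norm s p (F k)).
Proof.
move=> a0 as_ ap; apply: le_trans (lpn_minkowski (fun k i => lpn s (F k i)) a0 ap).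
apply: le_lpn_ge0 => [|i|i]; first exact: ltW (lt_le_trans a0 ap).
  exact: lpn_ge0.
exact: (lpn_minkowski (fun k j => F k i j)).
Qed.

(** The mirror move: the exponent [b], above both others, passes inwards first past [p] and then
    past [s]. *)
Lemma lpn_mixed_norm_le I J K b s p (F : K -> I -> J -> R) :
  0 < s -> 0 < p -> s <= b -> p <= b ->
  lpn b (fun k => mixed_norm s p (F k)) <=
  mixed_norm s p (fun i j => lpn b (fun k => F k i j)).
Proof.
move=> s0 p0 sb pb.
apply: le_trans (lpn_minkowski (fun i k => lpn s (F k i)) p0 pb) _.
apply: le_lpn_ge0 => [|i|i]; [exact: ltW|exact: lpn_ge0|].
exact: (lpn_minkowski (fun j k => F k i j)).
Qed.

(** Indexing a pair by ['I_2] makes it a family over a finite type, so that the Minkowski and power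
    mean inequalities apply to it. *)
Definition pair2 {T : Type} (u v : T) (k : 'I_2) : T := if k == ord0 then u else v.

Lemma lpn_pair2 p u v : lpn p (pair2 u v) = (`|u| `^ p + `|v| `^ p) `^ p^-1.
Proof. by rewrite /lpn !big_ord_recl big_ord0 addr0. Qed.

Lemma sqr_lpn2 I (f : I -> R) : lpn 2 f ^+ 2 = \sum_i f i ^+ 2.
Proof.
rewrite -powR_mulrn ?lpn_ge0// lpnK//; apply: eq_bigr => i _.
by rewrite powR_mulrn// real_normK// num_real.
Qed.

Lemma sqr_lpn2_ord2 (f : 'I_2 -> R) :
  lpn 2 f ^+ 2 = f ord0 ^+ 2 + f (lift ord0 ord0) ^+ 2.
Proof. by rewrite sqr_lpn2 !big_ord_recl big_ord0 addr0. Qed.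

(** The square root of [two_point_ineq]; the factor [2 ^ (1 / q)] turns the mean of the two powers
    into their sum. *)
Lemma lpn2_pair2_le q a b : 1 <= q <= 2 ->
  2 `^ q^-1 * lpn 2 (pair2 a (Num.sqrt (q - 1) * b)) <=
  lpn q (pair2 (a + b) (a - b)).
Proof.
move=> q12; have /andP[q1 q2] := q12.
have q0 : 0 < q := lt_le_trans ltr01 q1.
have := two_point_ineq a b q12.
have -> : a ^+ 2 + (q - 1) * b ^+ 2 = lpn 2 (pair2 a (Num.sqrt (q - 1) * b)) ^+ 2.
  rewrite sqr_lpn2_ord2/= exprMn sqr_sqrtr ?subr_ge0//.
set S := _ `^ q + _ => h.
rewrite [lpn q _]lpn_pair2 -/S.
have S0 : 0 <= S by apply: addr_ge0; exact: powR_ge0.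
have -> : S `^ q^-1 = 2 `^ q^-1 * (S / 2) `^ q^-1.
  by rewrite -powRM ?divr_ge0//; congr (_ `^ _); rewrite mulrC divfK.
apply: ler_wpM2l; first exact: powR_ge0.
rewrite -(@ler_pXn2r _ 2)// ?nnegrE ?lpn_ge0 ?powR_ge0//.
by rewrite -[leRHS]powR_mulrn ?powR_ge0// -powRrM [q^-1 * _]mulrC.
Qed.

(** The power mean inequality on two entries replaces exponent [q] by 2. The factors [2 ^ (1 / q)]
    cancel, and the remaining square root of 2 squares to the leading 2. *)
Lemma sqr_sum_ord2_le q (g f : 'I_2 -> R) : 0 < q -> q <= 2 ->
  2 `^ q^-1 * lpn 2 g <= lpn q f ->
  2 * (g ord0 ^+ 2 + g (lift ord0 ord0) ^+ 2) <=
  f ord0 ^+ 2 + f (lift ord0 ord0) ^+ 2.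
Proof.
move=> q0 q2 gf.
have := lpn_power_mean f q0 q2.
move=> /(le_trans (ler_wpM2l (powR_ge0 _ _) gf)).
rewrite mulrCA ler_pM2l ?powR_gt0// => /(sqr_le _).
rewrite mulr_ge0 ?powR_ge0 ?lpn_ge0// => /(_ isT).
by rewrite exprMn (powR12_sqrt (ler0n R 2)) (sqr_sqrtr (ler0n R 2)) !sqr_lpn2_ord2.
Qed.

Lemma mixed_norm_uniform_convex I J q s p (f g : I -> J -> R) :
  1 <= q -> q <= s <= 2 -> q <= p <= 2 ->
  2 * (mixed_norm s p f ^+ 2 + (q - 1) * mixed_norm s p g ^+ 2) <=
  mixed_norm s p (fun i j => f i j + g i j) ^+ 2 +
  mixed_norm s p (fun i j => f i j - g i j) ^+ 2.
Proof.
move=> q1 /andP[qs s2] /andP[qp p2].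
have q0 : 0 < q := lt_le_trans ltr01 q1.
have s0 : 0 < s := lt_le_trans q0 qs.
have p0 : 0 < p := lt_le_trans q0 qp.
have q2 : q <= 2 := le_trans qs s2.
pose F := pair2 (fun i j => f i j + g i j) (fun i j => f i j - g i j).
pose G := pair2 f (fun i j => Num.sqrt (q - 1) * g i j).
(* The exponent 2 over [G] moves inside, [lpn2_pair2_le] compares entry by entry, and the exponent
   [q] over [F] moves back outside. *)
have GF : 2 `^ q^-1 * lpn 2 (fun k => mixed_norm s p (G k)) <=
    lpn q (fun k => mixed_norm s p (F k)).
  apply: le_trans (mixed_norm_lpn_le F q0 qs qp).
  apply: (@le_trans _ _ (2 `^ q^-1 * mixed_norm s p (fun i j => lpn 2 (fun k => G k i j)))).
    apply: ler_wpM2l; first exact: powR_ge0.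
    exact: lpn_mixed_norm_le.
  rewrite -[X in X * _](ger0_norm (powR_ge0 2 q^-1)) -(mixed_normZ _ _ s0 p0).
  apply: le_mixed_norm; [exact: ltW|exact: ltW| |].
    by move=> i j; apply: mulr_ge0; [exact: powR_ge0|exact: lpn_ge0].
  move=> i j.
  have eG : (fun k => G k i j) =1 pair2 (f i j) (Num.sqrt (q - 1) * g i j).
    by move=> k; rewrite /G /pair2; case: ifP.
  have eF : (fun k => F k i j) =1 pair2 (f i j + g i j) (f i j - g i j).
    by move=> k; rewrite /F /pair2; case: ifP.
  rewrite (eq_lpn 2 eG) (eq_lpn q eF).
  by apply: lpn2_pair2_le; rewrite q1 q2.
have := sqr_sum_ord2_le q0 q2 GF.
have -> : mixed_norm s p (G (lift ord0 ord0)) = Num.sqrt (q - 1) * mixed_norm s p g.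
  by rewrite [LHS](mixed_normZ _ _ s0 p0) (ger0_norm (sqrtr_ge0 _)).
by rewrite exprMn sqr_sqrtr // subr_ge0.
Qed.
End Mixed.

(** * From midpoint convexity of a squared norm to strong convexity of its balls *)

Section UniformlyConvexNorm.
Set Implicit Arguments.
Unset Strict Implicit.
Context {R : realType} {V : lmodType R} (N : V -> R) (c : R).
Context (N_ge0 : forall x, 0 <= N x).
Context (ND : forall x y, N (x + y) <= N x + N y).
Context (NZ : forall a x, N (a *: x) = `|a| * N x).
Context (c_ge0 : 0 <= c).
Context (N_uniform_convex : forall x y,
  2 * (N x ^+ 2 + c * N y ^+ 2) <= N (x + y) ^+ 2 + N (x - y) ^+ 2).
Implicit Types (x y : V) (t r e : R).

(** Positive exactly where the strong convexity inequality fails; repeated halving bounds it by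
    arbitrarily small numbers. *)
Let defect x y t : R := N (t *: x + (1 - t) *: y) ^+ 2 -
  (t * N x ^+ 2 + (1 - t) * N y ^+ 2 - c * t * (1 - t) * N (x - y) ^+ 2).

Let NB x y : N (x - y) = N (y - x).
Proof. by rewrite -[x - y]opprB -[- _]scaleN1r NZ normrN1 mul1r. Qed.

Let defectC x y t : defect x y t = defect y x (1 - t).
Proof.
rewrite /defect subKr [(1 - t) *: y + _]addrC [N (y - x)]NB.
by move: (N _) (N _) (N _) (N _) => n1 n2 n3 n4; ring.
Qed.

(** The triangle inequality and the identity for the square of a weighted mean leave at most
    [c * t * (1 - t) * N (x - y) ^+ 2]. *)
Let defect_bound x y t : 0 <= t <= 1 -> defect x y t <= c * N (x - y) ^+ 2.
Proof.
move=> /andP[t0 t1]; rewrite /defect.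
have t1' : 0 <= 1 - t by rewrite subr_ge0.
have h : N (t *: x + (1 - t) *: y) <= t * N x + (1 - t) * N y.
  by apply: le_trans (ND _ _) _; rewrite !NZ !ger0_norm.
have := N_ge0 (t *: x + (1 - t) *: y).
move: (N _) (N x) (N y) h (sqr_ge0 (N (x - y))) => n u v h d0 n0.
have h2 : n ^+ 2 <= (t * u + (1 - t) * v) ^+ 2 by apply: sqr_le.
have h3 : 0 <= t * (1 - t) * (u - v) ^+ 2 := mulr_ge0 (mulr_ge0 t0 t1') (sqr_ge0 _).
have h4 : 0 <= 1 - t * (1 - t) by nra.
have h5 := mulr_ge0 (mulr_ge0 c_ge0 h4) d0.
nra.
Qed.

(* [t *: x + (1 - t) *: y] is the midpoint of [y] and [2t *: x + (1 - 2t) *: y]. *)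
Let defect_double x y t : 0 <= t <= 2^-1 -> defect x y t <= defect x y (2 * t) / 2.
Proof.
move=> /andP[t0 t1].
pose z := (2 * t) *: x + (1 - 2 * t) *: y.
have := N_uniform_convex (2^-1 *: (z + y)) (2^-1 *: (z - y)).
rewrite -scalerDr -scalerBr.
have -> : z + y + (z - y) = 2 *: z by rewrite addrACA subrr addr0 scaler_nat mulr2n.
have -> : z + y - (z - y) = 2 *: y by rewrite opprB addrC addrA subrK scaler_nat mulr2n.
rewrite !scalerA !mulVf// !scale1r.
have -> : 2^-1 *: (z + y) = t *: x + (1 - t) *: y.
  rewrite /z scalerDr scalerDr !scalerA -addrA -scalerDl.
  by congr (_ *: _ + _ *: _); field.
have -> : 2^-1 *: (z - y) = t *: (x - y).
  rewrite /z -addrA -[X in _ + (_ - X)]scale1r -scalerBl scalerDr !scalerA scalerBr -scaleNr.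
  by congr (_ *: _ + _ *: _); field.
rewrite NZ exprMn real_normK ?num_real// /defect -/z.
move: (N _) (N z) (N x) (N y) (N (x - y)) => n1 n2 n3 n4 n5.
lra.
Qed.

(** By [defectC] one may take [t <= 1 / 2]; then [2 * t] stays in [0, 1] and each use of
    [defect_double] gains a factor 2. *)
Let defect_pow2 n x y t : 0 <= t <= 1 ->
  defect x y t <= c * N (x - y) ^+ 2 / 2 ^+ n.
Proof.
elim: n x y t => [|n ih] x y t; first by rewrite expr0 divr1; exact: defect_bound.
wlog t2 : x y t / t <= 2^-1 => [h|] t01.
  have [/h|/ltW t2] := leP t 2^-1; first exact.
  by rewrite defectC NB; apply: h; lra.
apply: le_trans (defect_double _ _ _) _; first by rewrite t2; case/andP: t01 => ->.
rewrite [2 ^+ _.+1]exprSr invfM mulrA ler_pM2r ?invr_gt0//.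
by apply: ih; lra.
Qed.

Lemma norm_sqr_strongly_convex x y t : 0 <= t <= 1 ->
  N (t *: x + (1 - t) *: y) ^+ 2 <=
  t * N x ^+ 2 + (1 - t) * N y ^+ 2 - c * t * (1 - t) * N (x - y) ^+ 2.
Proof.
move=> t01; rewrite -subr_le0 leNgt; apply/negP => D0.
have M0 : 0 <= c * N (x - y) ^+ 2 by rewrite mulr_ge0 ?sqr_ge0.
(* This exponent [n] exceeds the bound divided by the defect, and [n <= 2 ^ n] contradicts
   [defect_pow2]. *)
have := defect_pow2 (Num.bound (c * N (x - y) ^+ 2 / defect x y t)) x y t01.
have := archi_boundP (divr_ge0 M0 (ltW D0)).
rewrite -/(defect x y t) in D0 *.
move: (Num.bound _) => n nD.
rewrite ltr_pdivrMr// in nD; rewrite ler_pdivlMr ?exprn_gt0// => Dn.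
have /(ler_wpM2r (ltW D0)) nn : n%:R <= 2 ^+ n :> R.
  by rewrite -natrX ler_nat ltnW// ltn_expl.
have := lt_le_trans nD (le_trans nn _); rewrite [2 ^+ n * _]mulrC => /(_ _ Dn).
by rewrite ltxx.
Qed.

(** Only the size of the perturbation [w] is constrained, so its direction may be normalised in a
    norm other than [N]. *)
Lemma norm_ball_strongly_convex r e x y t w : 0 < r -> 0 <= e <= c ->
  N x <= r -> N y <= r -> 0 <= t <= 1 ->
  N w <= t * (1 - t) * (e / r / 2) * N (x - y) ^+ 2 ->
  N (t *: x + (1 - t) *: y + w) <= r.
Proof.
move=> r0 /andP[e0 ec] xr yr t01 wr.
have sq := norm_sqr_strongly_convex x y t01.
have /andP[t0 t1] := t01.
apply: le_trans (ND _ _) _; apply: le_trans (lerD (lexx _) wr) _.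
have t1' : 0 <= 1 - t by rewrite subr_ge0.
have := N_ge0 (t *: x + (1 - t) *: y).
have xr2 := sqr_le (N_ge0 x) xr.
have yr2 := sqr_le (N_ge0 y) yr.
set d := t * (1 - t) * N (x - y) ^+ 2.
have d0 : 0 <= d by rewrite mulr_ge0 ?sqr_ge0// mulr_ge0.
have -> : t * (1 - t) * (e / r / 2) * N (x - y) ^+ 2 = e * d / (2 * r).
  by rewrite /d; field; rewrite gt_eqF.
have {}sq : N (t *: x + (1 - t) *: y) ^+ 2 <= r ^+ 2 - e * d.
  apply: le_trans sq _.
  have : t * N x ^+ 2 + (1 - t) * N y ^+ 2 <= r ^+ 2.
    rewrite [leRHS](_ : _ = t * r ^+ 2 + (1 - t) * r ^+ 2); last by ring.
    by apply: lerD; apply: ler_wpM2l.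
  have : e * d <= c * d by apply: ler_wpM2r.
  have -> : c * t * (1 - t) * N (x - y) ^+ 2 = c * d by rewrite /d !mulrA.
  lra.
set k := e * d / (2 * r).
have kE : e * d = 2 * r * k by rewrite /k; field; rewrite gt_eqF.
move: sq; rewrite kE; move: (N _) (k) => n k' sq n0.
rewrite -lerBrDr leNgt; apply/negP => h.
(* This follows from [0 <= n ^+ 2 <= r ^+ 2 - 2 * r * k']. It makes [r - k'] positive, so the
   negated goal [r - k' < n] can be squared into a contradiction. *)
have : k' <= r / 2.
  rewrite ler_pdivlMr// -(ler_pM2l r0).
  by have := sqr_ge0 n; nra.
nra.
Qed.
End UniformlyConvexNorm.

(** * Group and Frobenius norms of matrices, and strong convexity of the group ball *)

Section GroupNorm.
Set Implicit Arguments.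
Unset Strict Implicit.
Context {R : realType}.
Implicit Types (a b c e k p q r s t : R) (m n : nat).

Lemma group_normE s p m n (X : 'M[R]_(m, n)) :
  group_norm s p X = mixed_norm s p (fun i j => X i j).
Proof.
apply: eq_lpn => i; rewrite mxE.
by apply: eq_lpn => j; rewrite mxE.
Qed.

Lemma frobenius_normE m n (X : 'M[R]_(m, n)) :
  frobenius_norm X = mixed_norm 2 2 (fun i j => X i j).
Proof.
rewrite /frobenius_norm -[RHS]ger0_norm ?mixed_norm_ge0// -sqrtr_sqr.
by congr Num.sqrt; rewrite sqr_lpn2; apply: eq_bigr => i _; rewrite sqr_lpn2.
Qed.

Lemma group_norm_ge0 s p m n (X : 'M[R]_(m, n)) : 0 <= group_norm s p X.
Proof. by rewrite group_normE; exact: mixed_norm_ge0. Qed.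

Lemma group_normD_le s p m n (X Y : 'M[R]_(m, n)) : 1 <= s -> 1 <= p ->
  group_norm s p (X + Y) <= group_norm s p X + group_norm s p Y.
Proof.
move=> s1 p1; rewrite !group_normE; apply: le_trans (mixed_normD_le _ _ s1 p1).
rewrite le_eqVlt; apply/orP; left; apply/eqP.
by apply: eq_lpn => i; apply: eq_lpn => j; rewrite mxE.
Qed.

Lemma group_normZ s p m n c (X : 'M[R]_(m, n)) : 0 < s -> 0 < p ->
  group_norm s p (c *: X) = `|c| * group_norm s p X.
Proof.
move=> s0 p0; rewrite !group_normE -(mixed_normZ _ _ s0 p0).
by apply: eq_lpn => i; apply: eq_lpn => j; rewrite mxE.
Qed.

Lemma group_norm_uniform_convex q s p m n (X Y : 'M[R]_(m, n)) :
  1 <= q -> q <= s <= 2 -> q <= p <= 2 ->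
  2 * (group_norm s p X ^+ 2 + (q - 1) * group_norm s p Y ^+ 2) <=
  group_norm s p (X + Y) ^+ 2 + group_norm s p (X - Y) ^+ 2.
Proof.
move=> q1 qs qp.
have := mixed_norm_uniform_convex (fun i j => X i j) (fun i j => Y i j) q1 qs qp.
have -> : mixed_norm s p (fun i j => X i j + Y i j) = group_norm s p (X + Y).
  by rewrite group_normE; apply: eq_lpn => i; apply: eq_lpn => j; rewrite mxE.
have -> : mixed_norm s p (fun i j => X i j - Y i j) = group_norm s p (X - Y).
  by rewrite group_normE; apply: eq_lpn => i; apply: eq_lpn => j; rewrite !mxE.
by rewrite -!group_normE.
Qed.

Lemma frobenius_norm_le s p m n (X : 'M[R]_(m, n)) :
  0 < s <= 2 -> 0 < p <= 2 -> frobenius_norm X <= group_norm s p X.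
Proof.
move=> /andP[s0 s2] /andP[p0 p2]; rewrite group_normE frobenius_normE.
apply: le_trans (lpn_exponent_le _ p0 p2) _.
apply: le_lpn_ge0 => [|i|i]; [exact: ltW|exact: lpn_ge0|].
exact: lpn_exponent_le.
Qed.

Lemma lpn_power_mean_ratio n a b (f : 'I_n.+1 -> R) : 0 < a -> a <= b ->
  n.+1%:R `^ (b^-1 - a^-1) * lpn a f <= lpn b f.
Proof.
move=> a0 ab; rewrite powRB ?pnatr_eq0 ?implybT// mulrAC.
by rewrite ler_pdivrMr ?powR_gt0// [leRHS]mulrC lpn_power_mean.
Qed.

(** The power mean from [s] to 2 within rows of [n] entries gives the first factor, and from [p] to
    2 across the [m] rows the second. *)
Lemma group_norm_le_frobenius s p m n (X : 'M[R]_(m, n)) :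
  0 < s <= 2 -> 0 < p <= 2 -> (0 < m)%N -> (0 < n)%N ->
  n%:R `^ (1 / 2 - 1 / s) * m%:R `^ (1 / 2 - 1 / p) * group_norm s p X <=
  frobenius_norm X.
Proof.
case: m n X => [|m] [|n] X // /andP[s0 s2] /andP[p0 p2] _ _.
rewrite group_normE frobenius_normE !div1r [X in X * _ <= _]mulrC -mulrA.
have nk : 0 <= n.+1%:R `^ (2^-1 - s^-1) := powR_ge0 _ _.
rewrite -[X in _ * (X * _)](ger0_norm nk) /mixed_norm -(lpnZ _ _ p0).
apply: le_trans (lpn_power_mean_ratio _ p0 p2).
apply: ler_wpM2l; first exact: powR_ge0.
apply: le_lpn_ge0 => [|i|i]; [exact: ltW|exact: mulr_ge0 nk (lpn_ge0 _ _)|].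
exact: lpn_power_mean_ratio.
Qed.

(** Covers both norms of the theorem through [k * N <= M <= N], with [N] the group norm. If
    [M Z = 1], then [k * N Z <= 1] absorbs the factor [k] of the modulus, while
    [M (X - Y) <= N (X - Y)]. *)
Lemma group_ball_strongly_convex q e k s p r m n (M : 'M[R]_(m, n) -> R) :
  1 <= q -> q <= s <= 2 -> q <= p <= 2 -> 0 <= e <= q - 1 -> 0 < r -> 0 <= k ->
  (forall X, 0 <= M X) ->
  (forall X, M X <= group_norm s p X) -> (forall X, k * group_norm s p X <= M X) ->
  strongly_convex M (k * (e / r)) (group_ball s p r).
Proof.
move=> q1 qs qp e_le r0 k0 M0 MN kN.
have /andP[/(le_trans q1) s1 _] := qs; have s0 := lt_le_trans ltr01 s1.
have /andP[/(le_trans q1) p1 _] := qp; have p0 := lt_le_trans ltr01 p1.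
have c0 : 0 <= q - 1 by rewrite subr_ge0.
have ball X Y t Z := @norm_ball_strongly_convex R _ _ _ (@group_norm_ge0 s p m n)
  (fun X Y => group_normD_le X Y s1 p1) (fun a X => group_normZ a X s0 p0) c0
  (fun X Y => group_norm_uniform_convex X Y q1 qs qp) r e X Y t Z r0 e_le.
have e0 : 0 <= e by case/andP: e_le.
have t1_ge0 t : 0 <= t <= 1 -> 0 <= t * (1 - t).
  by move=> /andP[t0 t1]; rewrite mulr_ge0// subr_ge0.
have er0 : 0 <= e / r / 2 by rewrite !divr_ge0// ltW.
split=> [X Y t|X Y t Z XB YB t01 MZ].
  (* Convexity is the case of a zero perturbation. *)
  move=> /set_mem XB /set_mem YB; apply/mem_set.
  have t01 : 0 <= t%:num <= 1 by apply/andP; split.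
  have := ball X Y t%:num 0 XB YB t01.
  rewrite addr0; apply; rewrite -(scale0r (0 : 'M[R]_(m, n))).
  rewrite (group_normZ _ _ s0 p0) normr0 mul0r.
  exact: mulr_ge0 (mulr_ge0 (t1_ge0 _ t01) er0) (sqr_ge0 _).
apply: (ball _ _ _ _ XB YB t01); rewrite (group_normZ _ _ s0 p0).
have tt := t1_ge0 _ t01.
have h0 : 0 <= t * (1 - t) * (k * (e / r) / 2) * M (X - Y) ^+ 2.
  by rewrite -[k * _ / 2]mulrA; exact: mulr_ge0 (mulr_ge0 tt (mulr_ge0 k0 er0)) (sqr_ge0 _).
rewrite (ger0_norm h0).
have -> : t * (1 - t) * (k * (e / r) / 2) * M (X - Y) ^+ 2 * group_norm s p Z =
    t * (1 - t) * (e / r / 2) * M (X - Y) ^+ 2 * (k * group_norm s p Z).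
  move: (M _) (group_norm _ _ _) (e / r) => a b c; ring.
have kZ1 : k * group_norm s p Z <= 1 by have := kN Z; rewrite MZ.
have h1 : 0 <= t * (1 - t) * (e / r / 2) * M (X - Y) ^+ 2.
  exact: mulr_ge0 (mulr_ge0 tt er0) (sqr_ge0 _).
apply: le_trans (ler_wpM2l h1 kZ1) _; rewrite mulr1.
by apply: ler_wpM2l; [exact: mulr_ge0|exact: sqr_le].
Qed.

(** Half the harmonic mean; with [a = s - 1] and [b = p - 1] it is the constant of the theorem times
    [r]. *)
Lemma harmonic_le_min a b : 0 < a -> 0 < b -> 0 <= a * b / (a + b) <= Num.min a b.
Proof.
move=> a0 b0; have ab0 : 0 < a + b by rewrite addr_gt0.
apply/andP; split; first by rewrite divr_ge0 ?mulr_ge0 ?ltW.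
by rewrite le_min !ler_pdivrMr//; apply/andP; split; nra.
Qed.
End GroupNorm.

Theorem lemma8 (R : realType) (s p r : R) (m n : nat)
    (hs : 1 < s <= 2) (hp : 1 < p <= 2) (hr : 0 < r)
    (hm : (0 < m)%N) (hn : (0 < n)%N) :
  strongly_convex (fun X : 'M[R]_(m, n) => group_norm s p X)
    ((s - 1) * (p - 1) / ((s + p - 2) * r))
    (group_ball s p r) /\
  strongly_convex (fun X : 'M[R]_(m, n) => frobenius_norm X)
    (n%:R `^ (1 / 2 - 1 / s) * m%:R `^ (1 / 2 - 1 / p)
     * ((s - 1) * (p - 1) / ((s + p - 2) * r)))
    (group_ball s p r).
Proof.
have /andP[s1 s2] := hs; have /andP[p1 p2] := hp.
have s02 : 0 < s <= 2 by rewrite s2 (lt_trans ltr01 s1).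
have p02 : 0 < p <= 2 by rewrite p2 (lt_trans ltr01 p1).
(* The largest exponent to which Minkowski applies on both levels, hence the best constant
   [q - 1]. *)
pose q : R := Num.min s p.
have q1 : 1 <= q by rewrite le_min !ltW.
have qs : q <= s <= 2 by rewrite s2 ge_min lexx.
have qp : q <= p <= 2 by rewrite p2 ge_min lexx orbT.
set e := (s - 1) * (p - 1) / (s + p - 2).
have e_le : 0 <= e <= q - 1.
  have -> : q - 1 = Num.min (s - 1) (p - 1) by rewrite -addr_minl.
  have -> : e = (s - 1) * (p - 1) / ((s - 1) + (p - 1)).
    by rewrite /e; congr (_ / _); ring.
  by apply: harmonic_le_min; rewrite subr_gt0.
have -> : (s - 1) * (p - 1) / ((s + p - 2) * r) = e / r by rewrite invfM mulrA.
split.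
  rewrite -[e / r]mul1r.
  apply: (group_ball_strongly_convex q1 qs qp e_le hr ler01) => X.
  - exact: group_norm_ge0.
  - exact: lexx.
  - by rewrite mul1r.
apply: (group_ball_strongly_convex q1 qs qp e_le hr) => [|X|X|X].
- by rewrite mulr_ge0 ?powR_ge0.
- exact: sqrtr_ge0.
- exact: frobenius_norm_le.
- exact: group_norm_le_frobenius.
Qed.
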